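(* Let $\delta\in(0,\tfrac12)$. For every (arbitrarily small) $d>0$ there exist integers $\tilde r(m,d)$, $0\le\tilde r(m,d)\le m$, and a constant $c>0$ such that the limit $\lim_{m\to\infty}\binom{m}{\le\tilde r(m,d)}/2^m$ exists and satisfies \[\lim_{m\to\infty}\frac{\binom{m}{\le\tilde r(m,d)}}{2^m}\ge(1-d)(1-h(\delta)),\] and $a_{m,\tilde r(m,d)}\le 2^{-c\sqrt m}\,2^m$ for all sufficiently large $m$.
   Context: $h(\delta)=-\delta\log_2\delta-(1-\delta)\log_2(1-\delta)$ and $\binom{m}{\le r}=\sum_{i=0}^r\binom{m}{i}$. Every function $\mathbb{F}_2^m\to\mathbb{F}_2$ is uniquely a multilinear polynomial $\sum_{S\subseteq[m]}c_Sx_S$, $x_S=\prod_{i\in S}x_i$. Let $Z=(Z_x)_{x\in\mathbb{F}_2^m}$ have i.i.d. Bernoulli$(\delta)$ entries and let $W^{(m)}=(W_S)_{S\subseteq[m]}$ be the coefficient vector of the multilinear polynomial whose evaluation table is $Z$; $W^{(m)}_{\le r}=(W_S)_{|S|\le r}$, $W^{(m)}_{>r}=(W_S)_{|S|>r}$. Define $a_{m,r}:=H(W^{(m)}_{\le r}\mid W^{(m)}_{>r})$ (base-2 conditional Shannon entropy). *)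

(* Defs.v *)
From HB Require Import structures.
From mathcomp Require Import all_boot all_order all_algebra.
From mathcomp Require Import all_classical all_reals all_analysis.
Set Implicit Arguments. Unset Strict Implicit. Unset Printing Implicit Defensive.
Import Order.TTheory GRing.Theory Num.Theory.
Local Open Scope ring_scope.

(* Points of F_2^m are boolean vectors x : 'I_m -> bool. *)
Notation point m := {ffun 'I_m -> bool}.

(* The monomial x_S = prod_{i in S} x_i evaluated at x (over F_2). *)
Definition monomial (m : nat) (S : {set 'I_m}) (x : point m) : bool :=
  [forall i in S, x i].

(* Evaluation table of the multilinear polynomial sum_S c_S x_S over F_2
   (addition in F_2 is xor = addb). *)
Definition poly_eval (m : nat) (c : {ffun {set 'I_m} -> bool}) :
  {ffun point m -> bool} :=
  [ffun x => \big[addb/false]_(S : {set 'I_m}) (c S && monomial S x)].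

(* The (unique) coefficient vector of the multilinear polynomial whose
   evaluation table is f. *)
Definition coeffs (m : nat) (f : {ffun point m -> bool}) :
  {ffun {set 'I_m} -> bool} :=
  odflt [ffun _ => false] [pick c | poly_eval c == f].

Definition log2 {R : realType} (x : R) : R := ln x / ln 2.

Definition hbin {R : realType} (d : R) : R :=
  - d * log2 d - (1 - d) * log2 (1 - d).

Definition binom_le (m r : nat) : nat := \sum_(i < r.+1) 'C(m, i).

Definition Zprob {R : realType} (delta : R) (m : nat)
  (z : {ffun point m -> bool}) : R :=
  \prod_(x : point m) (if z x then delta else 1 - delta).

Definition cond_entropy {R : realType} {T A B : finType} (p : T -> R)
  (X : T -> A) (Y : T -> B) : R :=
  - \sum_(a : A) \sum_(b : B)
      let pab := \sum_(t | (X t == a) && (Y t == b)) p t in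
      let pb := \sum_(t | Y t == b) p t in
      if pab == 0 then 0 else pab * log2 (pab / pb).

(* W_{<= r} and W_{> r}: the coefficient subvectors, encoded as vectors
   indexed by all S with the other entries set to false. *)
Definition W_le (m r : nat) (z : {ffun point m -> bool}) :
  {ffun {set 'I_m} -> bool} :=
  [ffun S : {set 'I_m} => (#|S| <= r)%N && coeffs z S].
Definition W_gt (m r : nat) (z : {ffun point m -> bool}) :
  {ffun {set 'I_m} -> bool} :=
  [ffun S : {set 'I_m} => (r < #|S|)%N && coeffs z S].

Definition a_mr {R : realType} (delta : R) (m r : nat) : R :=
  cond_entropy (@Zprob R delta m) (@W_le m r) (@W_gt m r).

(* Main.v *)
(* Abbe-Sandon boosting.  Let Z be the noise and x0 a point.  Below capacity the
   entropy of (codeword + noise) is too small for every bit to be nearly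
   unpredictable from the others, so subadditivity of entropy yields some bit with
   an estimator phi of constant bias.  Apply phi to the restrictions of the received
   word to the translates through x0 of the graphs of all linear maps
   L : F_2^n -> F_2^k, m = n + k: a restricted Reed-Muller codeword is a Reed-Muller
   codeword of the same degree, and the rate changes by at most O(k / sqrt m).  Any
   point other than x0 lies on at most a 2^-k fraction of these graphs, so the sum of
   the estimators has relative variance at most 2^-k (sum over martingale
   differences), and Chebyshev gives bit error O(2^-k).  With k of order sqrt m this
   bounds the conditional entropy through Gibbs' inequality. *)
From HB Require Import structures.
From mathcomp Require Import all_boot all_order all_algebra.
From mathcomp Require Import all_classical all_reals all_analysis.
From mathcomp Require Import ring lra zify.
Require Import Defs.

Set Implicit Arguments. Unset Strict Implicit. Unset Printing Implicit Defensive.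
Import Order.TTheory GRing.Theory Num.Theory.
Import numFieldNormedType.Exports.
Local Open Scope ring_scope.

(** * Product measures on the cube *)

Definition upd {I : finType} (z : {ffun I -> bool}) (i : I) (b : bool) :
  {ffun I -> bool} := [ffun j => if j == i then b else z j].

Definition indep {R : realType} {I : finType} (i : I)
  (f : {ffun I -> bool} -> R) := forall z b, f (upd z i b) = f z.

Definition prob {R : realType} {I : finType} (t : R) (z : {ffun I -> bool}) : R :=
  \prod_(x : I) (if z x then t else 1 - t).

Definition Ex {R : realType} {I : finType} (t : R)
  (f : {ffun I -> bool} -> R) : R := \sum_z prob t z * f z.

(** Conditional expectation given all coordinates other than [i], kept as a function on the whole
    cube so that such averages compose. *)
Definition avg {R : realType} {I : finType} (t : R) (i : I)
  (f : {ffun I -> bool} -> R) : {ffun I -> bool} -> R :=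
  fun z => (1 - t) * f (upd z i false) + t * f (upd z i true).

Definition avgs {R : realType} {I : finType} (t : R) (s : seq I)
  (f : {ffun I -> bool} -> R) : {ffun I -> bool} -> R := foldr (avg t) f s.

Lemma updE {I : finType} (z : {ffun I -> bool}) i : upd z i (z i) = z.
Proof. by apply/ffunP => j; rewrite ffunE; case: eqP => [->|]. Qed.

Lemma upd_upd {I : finType} (z : {ffun I -> bool}) i b c :
  upd (upd z i b) i c = upd z i c.
Proof. by apply/ffunP => j; rewrite !ffunE; case: eqP. Qed.

Lemma updC {I : finType} (z : {ffun I -> bool}) i j b c :
  i != j -> upd (upd z i b) j c = upd (upd z j c) i b.
Proof.
move=> ij; apply/ffunP => k; rewrite !ffunE.
by case: (eqVneq k j) => [->|//]; rewrite eq_sym (negbTE ij).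
Qed.

Lemma sum_upd {R : realType} {I : finType} (i : I) (G : {ffun I -> bool} -> R) :
  \sum_z G z = \sum_z (G (upd z i false) + G (upd z i true)) / 2.
Proof.
pose flip (z : {ffun I -> bool}) := upd z i (~~ z i).
have flipK : involutive flip.
  by move=> z; rewrite /flip upd_upd ffunE eqxx negbK updE.
have -> : \sum_z G z = \sum_z (G z + G (flip z)) / 2.
  rewrite -mulr_suml big_split /=.
  have -> : \sum_z G (flip z) = \sum_z G z.
    by rewrite [RHS](reindex_inj (inv_inj flipK)).
  by field.
apply: eq_bigr => z _; rewrite /flip.
have := updE z i; case: (z i) => /= E; congr (_ / 2); last by rewrite E.
by rewrite E addrC.
Qed.

Lemma indep_avg {R : realType} {I : finType} (t : R) i
  (f : {ffun I -> bool} -> R) : indep i (avg t i f).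
Proof. by move=> z b; rewrite /avg !upd_upd. Qed.

Lemma indep_avg_other {R : realType} {I : finType} (t : R) i j
  (f : {ffun I -> bool} -> R) : indep j f -> indep j (avg t i f).
Proof.
move=> fj; case: (eqVneq i j) => [<-|ij]; first exact: indep_avg.
by move=> z b; rewrite /avg !(@updC _ z j i) 1?eq_sym // !fj.
Qed.

Lemma avg_id {R : realType} {I : finType} (t : R) i
  (f : {ffun I -> bool} -> R) z : indep i f -> avg t i f z = f z.
Proof. by move=> fi; rewrite /avg !fi; ring. Qed.

Lemma avg_mull {R : realType} {I : finType} (t : R) i
  (f g : {ffun I -> bool} -> R) z :
  indep i f -> avg t i (fun z => f z * g z) z = f z * avg t i g z.
Proof. by move=> fi; rewrite /avg !fi; ring. Qed.

Lemma indep_avgs {R : realType} {I : finType} (t : R) s i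
  (f : {ffun I -> bool} -> R) : i \in s \/ indep i f -> indep i (avgs t s f).
Proof.
elim: s => [|j s IH] /= => [[]//|].
rewrite inE => -[/orP[/eqP->|si]|fi].
- exact: indep_avg.
- by apply: indep_avg_other; apply: IH; left.
- by apply: indep_avg_other; apply: IH; right.
Qed.

Lemma indep_const {R : realType} {I : finType} (f : {ffun I -> bool} -> R) z z' :
  (forall i, indep i f) -> f z = f z'.
Proof.
move=> fi.
have H s : f (foldr (fun i y => upd y i (z i)) z' s) = f z'.
  by elim: s => //= i s IH; rewrite fi.
rewrite -(H (enum I)); congr f; apply/ffunP => j.
have: j \in enum I by rewrite mem_enum.
elim: (enum I) => //= i s IH; rewrite inE ffunE.
by case: eqP => [->|_] //=.
Qed.

Lemma prob_ge0 {R : realType} {I : finType} (t : R) (z : {ffun I -> bool}) :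
  0 <= t <= 1 -> 0 <= prob t z.
Proof.
by move=> /andP[t0 t1]; apply: prodr_ge0 => x _; case: ifP => // _; rewrite subr_ge0.
Qed.

Lemma prob_gt0 {R : realType} {I : finType} (t : R) (z : {ffun I -> bool}) :
  0 < t < 1 -> 0 < prob t z.
Proof.
by move=> /andP[t0 t1]; apply: prodr_gt0 => x _; case: ifP => // _; rewrite subr_gt0.
Qed.

Lemma sum_prob_fun {R : realType} {I : finType} (F : I -> bool -> R) :
  (forall x, F x true + F x false = 1) ->
  \sum_(z : {ffun I -> bool}) \prod_x F x (z x) = 1.
Proof.
move=> F1; rewrite -(bigA_distr_bigA F).
by rewrite big1 // => x _; rewrite -(F1 x) big_bool.
Qed.

Lemma sum_prob {R : realType} {I : finType} (t : R) :
  \sum_(z : {ffun I -> bool}) prob t z = 1.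
Proof.
rewrite /prob -[RHS](@sum_prob_fun R I (fun x b => if b then t else 1 - t)) //.
by move=> x; ring.
Qed.

Lemma prob_upd {R : realType} {I : finType} (t : R) (z : {ffun I -> bool}) i b :
  prob t (upd z i b) = (if b then t else 1 - t) *
    \prod_(x | x != i) (if z x then t else 1 - t).
Proof.
rewrite /prob (bigD1 i) //= ffunE eqxx; congr (_ * _).
by apply: eq_bigr => j /negbTE ji; rewrite ffunE ji.
Qed.

Lemma Ex_avg {R : realType} {I : finType} (t : R) i (f : {ffun I -> bool} -> R) :
  Ex t (avg t i f) = Ex t f.
Proof.
rewrite /Ex (sum_upd i) [RHS](sum_upd i); apply: eq_bigr => z _; congr (_ / 2).
by rewrite !prob_upd !indep_avg /avg; ring.
Qed.

Lemma Ex_avgs {R : realType} {I : finType} (t : R) s (f : {ffun I -> bool} -> R) :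
  Ex t (avgs t s f) = Ex t f.
Proof. by elim: s => //= i s IH; rewrite Ex_avg. Qed.

Lemma eq_Ex {R : realType} {I : finType} (t : R) (f g : {ffun I -> bool} -> R) :
  f =1 g -> Ex t f = Ex t g.
Proof. by move=> fg; apply: eq_bigr => z _; rewrite fg. Qed.

Lemma Ex_const {R : realType} {I : finType} (t c : R) :
  Ex t (fun _ : {ffun I -> bool} => c) = c.
Proof. by rewrite /Ex -mulr_suml sum_prob mul1r. Qed.

Lemma ExD {R : realType} {I : finType} (t : R) (f g : {ffun I -> bool} -> R) :
  Ex t (fun z => f z + g z) = Ex t f + Ex t g.
Proof. by rewrite /Ex -big_split /=; apply: eq_bigr => z _; rewrite mulrDr. Qed.

Lemma ExZ {R : realType} {I : finType} (t a : R) (f : {ffun I -> bool} -> R) :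
  Ex t (fun z => a * f z) = a * Ex t f.
Proof. by rewrite /Ex mulr_sumr; apply: eq_bigr => z _; rewrite mulrCA. Qed.

Lemma ExN {R : realType} {I : finType} (t : R) (f : {ffun I -> bool} -> R) :
  Ex t (fun z => - f z) = - Ex t f.
Proof. by rewrite -mulN1r -ExZ; apply: eq_Ex => z; rewrite mulN1r. Qed.

Lemma ExB {R : realType} {I : finType} (t : R) (f g : {ffun I -> bool} -> R) :
  Ex t (fun z => f z - g z) = Ex t f - Ex t g.
Proof. by rewrite -ExN -ExD. Qed.

Lemma Ex_sum {R : realType} {I K : finType} (P : pred K) (t : R)
  (f : K -> {ffun I -> bool} -> R) :
  Ex t (fun z => \sum_(l | P l) f l z) = \sum_(l | P l) Ex t (f l).
Proof.
rewrite /Ex exchange_big /=; apply: eq_bigr => z _; exact: mulr_sumr.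
Qed.

Lemma ler_Ex {R : realType} {I : finType} (t : R) (f g : {ffun I -> bool} -> R) :
  0 <= t <= 1 -> (forall z, f z <= g z) -> Ex t f <= Ex t g.
Proof.
move=> t01 fg; apply: ler_sum => z _; apply: ler_wpM2l (fg z).
exact: prob_ge0.
Qed.

(** Once every coordinate is averaged out the function is constant, and averaging preserves the
    expectation. *)
Lemma avgs_enum {R : realType} {I : finType} (t : R) (f : {ffun I -> bool} -> R) z :
  avgs t (enum I) f z = Ex t f.
Proof.
rewrite -(Ex_avgs t (enum I)) -[LHS](@Ex_const R I t); apply: eq_Ex => z'.
by apply: indep_const => i; apply: indep_avgs; left; rewrite mem_enum.
Qed.

(** Averaging is an orthogonal projection for the inner product given by the expectation of a
    product. *)
Lemma Ex_mul_avg {R : realType} {I : finType} (t : R) i (f g : {ffun I -> bool} -> R) :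
  Ex t (fun z => f z * avg t i g z) = Ex t (fun z => avg t i f z * avg t i g z).
Proof.
rewrite -(Ex_avg t i); apply: eq_Ex => z.
rewrite mulrC -(avg_mull _ _ _ (indep_avg t i g)); congr (_ * _ + _ * _);
  exact: mulrC.
Qed.

Lemma sqr_sum_le {R : realType} {K : finType} (D : {set K}) (a : K -> R) :
  (\sum_(l in D) a l) ^+ 2 <= #|D|%:R * \sum_(l in D) a l ^+ 2.
Proof.
rewrite expr2 mulr_suml.
apply: (@le_trans _ _ (\sum_(i in D) \sum_(j in D) (a i ^+ 2 + a j ^+ 2) / 2)).
  apply: ler_sum => i _; rewrite mulr_sumr; apply: ler_sum => j _.
  have := sqr_ge0 (a i - a j); nra.
have E (i : K) : \sum_(j in D) (a i ^+ 2 + a j ^+ 2) / 2 =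
   (#|D|%:R * a i ^+ 2 + \sum_(j in D) a j ^+ 2) / 2.
  by rewrite -mulr_suml big_split /= sumr_const mulr_natl.
rewrite (eq_bigr _ (fun i _ => E i)) -mulr_suml big_split /= sumr_const -mulr_sumr.
by rewrite -mulr_natl; lra.
Qed.

(* The martingale differences [g - avg t i g] of the summands that do not depend
   on coordinate [i] vanish, so Cauchy-Schwarz only costs a factor [M]. *)
Lemma variance_sum_le {R : realType} {I K : finType} (t : R) (M : nat)
  (f : K -> {ffun I -> bool} -> R) :
  0 <= t <= 1 ->
  (forall i, exists2 D : {set K}, (#|D| <= M)%N &
     forall l, l \notin D -> indep i (f l)) ->
  forall s,
  Ex t (fun z => (\sum_l f l z) ^+ 2) - Ex t (fun z => (\sum_l avgs t s (f l) z) ^+ 2)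
  <= M%:R * \sum_l (Ex t (fun z => f l z ^+ 2) - Ex t (fun z => avgs t s (f l) z ^+ 2)).
Proof.
move=> t01 Hf; elim=> [|i s IH] /=.
  by rewrite subrr big1 ?mulr0 // => l _; rewrite subrr.
pose g l := avgs t s (f l).
(* Pythagoras for the projection [avg t i]. *)
have sqE (h : {ffun I -> bool} -> R) : Ex t (fun z => h z ^+ 2) - Ex t (fun z => avg t i h z ^+ 2) =
   Ex t (fun z => (h z - avg t i h z) ^+ 2).
  have -> : Ex t (fun z => (h z - avg t i h z) ^+ 2) =
      Ex t (fun z => h z ^+ 2 - 2 * (h z * avg t i h z) + avg t i h z ^+ 2).
    by apply: eq_Ex => z; ring.
  rewrite ExD ExB ExZ Ex_mul_avg.
  have -> : Ex t (fun z => avg t i h z * avg t i h z) = Ex t (fun z => avg t i h z ^+ 2).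
    by apply: eq_Ex => z; rewrite expr2.
  by ring.
have [D DM HD] := Hf i.
have step : Ex t (fun z => (\sum_l g l z) ^+ 2) - Ex t (fun z => (\sum_l avg t i (g l) z) ^+ 2)
  <= M%:R * \sum_l (Ex t (fun z => g l z ^+ 2) - Ex t (fun z => avg t i (g l) z ^+ 2)).
  have avE z : \sum_l avg t i (g l) z = avg t i (fun z => \sum_l g l z) z.
    by rewrite /avg !mulr_sumr -big_split.
  under [X in _ - X](eq_Ex t) do rewrite avE.
  rewrite sqE; under eq_bigr do rewrite sqE.
  rewrite -Ex_sum -ExZ; apply: ler_Ex => // z.
  rewrite -avE -sumrB (bigID (mem D)) /= [X in _ + X]big1 ?addr0; last first.
    by move=> l lD; rewrite avg_id ?subrr //; apply: indep_avgs; right; exact: HD.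
  apply: le_trans (sqr_sum_le _ _) _.
  apply: ler_pM => //; first by apply: sumr_ge0 => l _; exact: sqr_ge0.
    by rewrite ler_nat.
  rewrite [leRHS](bigID (mem D)) /= lerDl.
  by apply: sumr_ge0 => l _; exact: sqr_ge0.
have := lerD IH step; rewrite -mulrDr -big_split /=.
under [X in _ <= _ * X -> _]eq_bigr do rewrite addrA subrK.
by rewrite addrA subrK.
Qed.

(** * Biased estimators from entropy *)

(** Addition in F_2^I, used both for words, where [I] is a set of points, and for the points
    themselves. *)
Definition vadd {I : finType} (z c : {ffun I -> bool}) : {ffun I -> bool} :=
  [ffun x => z x (+) c x].

Lemma vaddC {I : finType} (z c : {ffun I -> bool}) : vadd z c = vadd c z.
Proof. by apply/ffunP => x; rewrite !ffunE addbC. Qed.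

Lemma vaddA {I : finType} (z c d : {ffun I -> bool}) :
  vadd z (vadd c d) = vadd (vadd z c) d.
Proof. by apply/ffunP => x; rewrite !ffunE addbA. Qed.

Lemma vaddK {I : finType} (c : {ffun I -> bool}) : involutive (vadd^~ c).
Proof. by move=> z; apply/ffunP => x; rewrite !ffunE -addbA addbb addbF. Qed.

Lemma ln_le_sub1 {R : realType} (x : R) : 0 < x -> ln x <= x - 1.
Proof.
move=> x0; have E : 1 + (x - 1) = x by ring.
by have := @le_ln1Dx R (x - 1); rewrite E; apply; lra.
Qed.

Lemma prob_half {R : realType} {I : finType} (z : {ffun I -> bool}) :
  prob (1 / 2 : R) z = (2 ^+ #|I|)^-1.
Proof.
rewrite /prob (eq_bigr (fun=> 2^-1)) ?prodr_const ?exprVn //.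
by move=> x _; case: ifP => _; lra.
Qed.

Lemma Ex_coord {R : realType} {I : finType} (t : R) (x : I) (g : bool -> R) :
  Ex t (fun z : {ffun I -> bool} => g (z x)) = (1 - t) * g false + t * g true.
Proof.
rewrite -(Ex_avg t x) (eq_Ex t (g := fun=> (1 - t) * g false + t * g true)).
  exact: Ex_const.
by move=> z; rewrite /avg !ffunE !eqxx.
Qed.

Lemma avg_gt0 {R : realType} {I : finType} (t : R) i (f : {ffun I -> bool} -> R) :
  0 < t < 1 -> (forall z, 0 < f z) -> forall z, 0 < avg t i f z.
Proof.
by move=> /andP[t0 t1] f0 z; rewrite addr_gt0 // mulr_gt0 // subr_gt0.
Qed.

(* Gibbs' inequality for each conditional law, telescoped along [avgs]. *)
Lemma entropy_subadditive {R : realType} {I : finType} (t : R) s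
    (f : {ffun I -> bool} -> R) :
  0 < t < 1 -> (forall z, 0 < f z) ->
  Ex t (fun z => f z * ln (f z)) - Ex t (fun z => f z * ln (avgs t s f z))
  <= \sum_(i <- s) (Ex t (fun z => f z * ln (f z)) -
                    Ex t (fun z => f z * ln (avg t i f z))).
Proof.
move=> t01 f0; elim: s => [|i s IH]; first by rewrite big_nil subrr.
have g0 : forall z, 0 < avgs t s f z.
  by elim: s {IH} => //= j s IH; exact: avg_gt0.
rewrite big_cons /=; set g := avgs t s f in IH g0 *.
have a0 := avg_gt0 i t01 f0; have b0 := avg_gt0 i t01 g0.
(* What remains is that the conditional law of coordinate [i] under the density [f] has nonnegative
   relative entropy with respect to the one under [g]. *)
suff : Ex t (fun z => f z * ln (g z)) - Ex t (fun z => f z * ln (avg t i g z)) <=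
       Ex t (fun z => f z * ln (f z)) - Ex t (fun z => f z * ln (avg t i f z)).
  by move: IH; lra.
rewrite -subr_le0 -!ExB.
apply: (@le_trans _ _ (Ex t (fun z => avg t i f z / avg t i g z * g z - f z))).
  apply: ler_Ex => [|z]; first by move: t01; lra.
  have -> : f z * ln (g z) - f z * ln (avg t i g z) -
     (f z * ln (f z) - f z * ln (avg t i f z)) =
     f z * ln (g z * avg t i f z / (avg t i g z * f z)).
    rewrite ln_div ?lnM ?posrE ?mulr_gt0 ?f0 ?g0 ?a0 ?b0 //; ring.
  apply: le_trans (ler_wpM2l (ltW (f0 z)) (ln_le_sub1 _)) _.
    by rewrite divr_gt0 ?mulr_gt0.
  rewrite le_eqVlt; apply/orP; left; apply/eqP.
  by have := lt0r_neq0 (f0 z); have := lt0r_neq0 (b0 z) => ? ?; field; apply/andP.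
(* [avg t i f / avg t i g] ignores coordinate [i], so averaging turns the factor [g] into
   [avg t i g], which cancels; both terms then have the expectation of [f]. *)
rewrite ExB -(Ex_avg t i).
rewrite (eq_Ex t (g := avg t i f)) ?Ex_avg ?subrr // => z.
rewrite avg_mull ?divfK ?gt_eqF // => y b.
by rewrite !indep_avg.
Qed.

Lemma ln_prod {R : realType} {I : finType} (F : I -> R) :
  (forall i, 0 < F i) -> ln (\prod_i F i) = \sum_i ln (F i).
Proof.
move=> F0.
suff [] : 0 < \prod_i F i /\ ln (\prod_i F i) = \sum_i ln (F i) by [].
apply: (big_ind2 (fun a b => 0 < a /\ ln a = b)) => //; first by rewrite ln1.
by move=> a b c d [a0 <-] [c0 <-]; rewrite mulr_gt0 // lnM.
Qed.

Definition hnat {R : realType} (t : R) : R := - t * ln t - (1 - t) * ln (1 - t).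

Lemma Ex_ln_prob {R : realType} {I : finType} (t : R) : 0 < t < 1 ->
  Ex t (fun z : {ffun I -> bool} => ln (prob t z)) = - (#|I|%:R * hnat t).
Proof.
move=> t01.
have lnprob (z : {ffun I -> bool}) : ln (prob t z) =
    \sum_x ln (if z x then t else 1 - t).
  by rewrite ln_prod // => x; case: ifP => _; lra.
rewrite (eq_Ex t lnprob) (Ex_sum xpredT t (fun x z => ln (if z x then t else 1 - t))).
rewrite (eq_bigr (fun=> - hnat t)); first by rewrite sumrN sumr_const mulr_natl.
by move=> x _; rewrite (Ex_coord t x (fun b => ln (if b then t else 1 - t))) /hnat; ring.
Qed.

Lemma Ex_vadd {R : realType} {I : finType} (t : R) (c : {ffun I -> bool}) g :
  \sum_y prob t (vadd y c) * g y = Ex t (fun z => g (vadd z c)).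
Proof.
rewrite (reindex_inj (inv_inj (vaddK c))) /=.
by apply: eq_bigr => z _; rewrite vaddK.
Qed.

(* [f] is the density of (uniform codeword + noise) relative to the uniform law;
   its relative entropy is at least [#|I| ln 2 - ln #|C| - #|I| h], hence one
   coordinate carries at least the average share of it. *)
Lemma exists_weak_estimator {R : realType} {I : finType}
    (C : {set {ffun I -> bool}}) (t eta : R) :
  0 < t < 1 / 2 -> (0 < #|I|)%N -> [ffun=> false] \in C ->
  (forall c d, c \in C -> d \in C -> vadd c d \in C) ->
  0 <= eta ->
  #|I|%:R * eta <= #|I|%:R * (ln 2 - hnat t) - ln (#|C|%:R) ->
  exists i (phi : {ffun I -> bool} -> R),
    [/\ indep i phi, forall z, `|phi z| <= 1,
        forall c z, c \in C -> phi (vadd z c) = (-1) ^+ (c i) * phi z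
      & eta <= Ex t phi].
Proof.
move=> t01 I0 C0 CD eta0 Heta.
have t01' : 0 < t < 1 by lra.
have half01 : 0 < (1 / 2 : R) < 1 by lra.
have cardC : 0 < #|C|%:R :> R.
  by rewrite ltr0n; apply/card_gt0P; exists [ffun=> false].
pose q y : R := #|C|%:R^-1 * \sum_(c in C) prob t (vadd y c).
pose f y : R := 2 ^+ #|I| * q y.
have pow0 : 0 < 2 ^+ #|I| :> R by rewrite exprn_gt0.
(* Only the zero codeword is kept in the sum; the denominator [#|C|] becomes the term [- ln #|C|] of
   the entropy bound. *)
have q_ge y : prob t y / #|C|%:R <= q y.
  rewrite /q mulrC ler_pM2l ?invr_gt0 // (bigD1 [ffun=> false]) //=.
  have -> : vadd y [ffun=> false] = y by apply/ffunP => x; rewrite !ffunE addbF.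
  by rewrite lerDl; apply: sumr_ge0 => c _; apply: prob_ge0; lra.
have q0 y : 0 < q y by apply: lt_le_trans (q_ge y); rewrite divr_gt0 // prob_gt0.
have f0 y : 0 < f y by rewrite mulr_gt0.
have qC c y : c \in C -> q (vadd y c) = q y.
  move=> cC; rewrite /q [X in _ * X = _](reindex_inj (inv_inj (vaddK c))) /=; congr (_ * _).
  apply: eq_big => [d|d _]; last by rewrite [vadd d c]vaddC vaddA vaddK.
  by apply/idP/idP => [dC|dC]; [rewrite -(vaddK c d)|]; exact: CD.
have Exf g : Ex (1 / 2) (fun y => f y * g y) =
    #|C|%:R^-1 * \sum_(c in C) Ex t (fun z => g (vadd z c)).
  under [in RHS]eq_bigr do rewrite -Ex_vadd.
  rewrite exchange_big mulr_sumr /=; apply: eq_bigr => y _.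
  rewrite prob_half /f mulrA mulrA mulVf ?gt_eqF // mul1r /q -mulrA; congr (_ * _).
  by rewrite mulr_suml.
(* A function invariant under the code cannot tell codeword plus noise from noise alone. *)
have Exf_inv g : (forall c z, c \in C -> g (vadd z c) = g z) ->
    Ex (1 / 2) (fun y => f y * g y) = Ex t g.
  move=> gC; rewrite Exf (eq_bigr (fun=> Ex t g)); last first.
    by move=> c cC; apply: eq_Ex => z; exact: gC.
  by rewrite sumr_const -[X in _ * X]mulr_natl mulrA mulVf ?mul1r ?gt_eqF.
have fC c y : c \in C -> f (vadd y c) = f y by move=> cC; rewrite /f qC.
have Ex1 : Ex (1 / 2) f = 1.
  have E : Ex (1 / 2) (fun y => f y * 1) = Ex t (fun _ : {ffun I -> bool} => 1).
    exact: (Exf_inv (fun=> 1)).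
  by rewrite -[RHS](Ex_const (I := I) t 1) -E; apply: eq_Ex => z; rewrite mulr1.
have ent : #|I|%:R * eta <= Ex (1 / 2) (fun y => f y * ln (f y)) -
    Ex (1 / 2) (fun y => f y * ln (avgs (1 / 2) (enum I) f y)).
  have -> : Ex (1 / 2) (fun y => f y * ln (avgs (1 / 2) (enum I) f y)) = 0.
    rewrite -(Ex_const (I := I) (1 / 2) 0); apply: eq_Ex => y.
    by rewrite avgs_enum Ex1 ln1 mulr0.
  rewrite subr0 Exf_inv => [|c z cC]; last by rewrite fC.
  apply: le_trans Heta _.
  apply: (@le_trans _ _ (Ex t (fun z : {ffun I -> bool} =>
     #|I|%:R * ln 2 - ln (#|C|%:R) + ln (prob t z)))).
    by rewrite ExD Ex_const Ex_ln_prob //; lra.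
  apply: ler_Ex => [|z]; first by lra.
  apply: (@le_trans _ _ (ln (2 ^+ #|I| * (prob t z / #|C|%:R)))).
    have p0 := prob_gt0 z t01'.
    rewrite lnM ?posrE ?divr_gt0 // lnXn // ln_div ?posrE // mulr_natl; lra.
  have p0 := prob_gt0 z t01'.
  rewrite ler_ln ?posrE ?f0 //; last by rewrite mulr_gt0 // divr_gt0.
  by rewrite ler_pM2l.
have {ent} := le_trans ent (entropy_subadditive _ half01 f0).
rewrite big_enum /= (eq_bigl xpredT) // => ent.
have [i Hi] : exists i, eta <= Ex (1 / 2) (fun z => f z * ln (f z)) -
                    Ex (1 / 2) (fun z => f z * ln (avg (1 / 2) i f z)).
  apply: contrapT => /forallNP H.
  have : \sum_(i : I) (Ex (1 / 2) (fun z => f z * ln (f z)) -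
     Ex (1 / 2) (fun z => f z * ln (avg (1 / 2) i f z))) < \sum_(i : I) eta.
    apply: ltr_sum => [|i _]; last by rewrite ltNge; apply/negP; exact: H.
    by have /card_gt0P[i _] := I0; apply/hasP; exists i; rewrite ?mem_index_enum.
  by rewrite sumr_const -[X in _ < X]mulr_natl ltNge => /negP; apply; exact: ent.
(* When [y] has density [f], this is the conditional mean of [(-1) ^+ y i] given the other
   coordinates. *)
pose phi y := (f (upd y i false) - f (upd y i true)) /
              (f (upd y i false) + f (upd y i true)).
have phi_indep : indep i phi by move=> z b; rewrite /phi !upd_upd.
pose psi y := f y / avg (1 / 2) i f y - 1.
have psiE y : psi y = (-1) ^+ y i * phi y.
  have := f0 (upd y i false); have := f0 (upd y i true).
  rewrite /psi /phi /avg; have := updE y i.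
  set a := f (upd y i true); set b := f (upd y i false).
  by case: (y i) => E a0 b0; [have -> : f y = a by rewrite /a E|
     have -> : f y = b by rewrite /b E]; rewrite ?expr1 ?expr0; field; lra.
have upd_vadd c y b : c \in C -> f (upd (vadd y c) i b) = f (upd y i (b (+) c i)).
  move=> cC; rewrite -[in RHS](fC c) //; congr f; apply/ffunP => x.
  by rewrite !ffunE; case: eqP => [->|//]; rewrite -addbA addbb addbF.
exists i, phi; split => //.
- move=> z; have a0 := f0 (upd z i false); have b0 := f0 (upd z i true).
  rewrite /phi normrM normfV [X in _ / X]gtr0_norm ?addr_gt0 //.
  by rewrite ler_pdivrMr ?addr_gt0 // mul1r ler_norml; lra.
- move=> c z cC; rewrite /phi !upd_vadd // addTb addFb.
  have a0 := f0 (upd z i false); have b0 := f0 (upd z i true).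
  by case: (c i); rewrite /= ?expr1 ?expr0; field; lra.
(* The information carried by coordinate [i] is the mean of the logarithm of [psi + 1], hence at
   most the mean of [psi]. *)
have Epsi : eta <= Ex t psi.
  rewrite -(Exf_inv psi) => [|c z cC]; last first.
    by rewrite /psi /avg !upd_vadd // fC //; congr (_ / _ - 1); case: (c i) => /=; lra.
  apply: le_trans Hi _; rewrite -ExB; apply: ler_Ex => [|z]; first by lra.
  have a0 := avg_gt0 i half01 f0 z.
  rewrite -mulrBr -ln_div ?posrE //; apply: ler_wpM2l (ln_le_sub1 _) => //.
    exact: ltW.
  by rewrite divr_gt0.
(* The noise bit at [i] is independent of [phi], and [(-1) ^+ z i] has mean [1 - 2 * t]. *)
have : Ex t psi = (1 - 2 * t) * Ex t phi.
  rewrite -ExZ -(Ex_avg t i); apply: eq_Ex => z.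
  by rewrite /avg !psiE !phi_indep !ffunE !eqxx expr0 expr1; ring.
move: Epsi => /[swap] -> Epsi.
have E0 : 0 <= Ex t phi.
  by rewrite -(pmulr_rge0 _ (_ : 0 < 1 - 2 * t)); [exact: le_trans Epsi | lra].
nra.
Qed.

(** * Voting *)

(** An i.i.d. word read along an injection is again i.i.d.: in each fibre the coordinates outside
    the image are free and contribute a factor 1. *)
Lemma Ex_pullback {R : realType} {I J : finType} (t : R) (T : I -> J)
    (f : {ffun I -> bool} -> R) : injective T ->
  Ex t (fun z : {ffun J -> bool} => f [ffun i => z (T i)]) = Ex t f.
Proof.
move=> Tinj; rewrite /Ex.
rewrite (partition_big (fun z : {ffun J -> bool} => [ffun i => z (T i)]) xpredT) //=.
apply: eq_bigr => y _.
under eq_bigr => z /eqP E do rewrite E.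
rewrite -mulr_suml; congr (_ * _).
pose w (b : bool) : R := if b then t else 1 - t.
pose inv x := [pick i | T i == x].
have invT i : inv (T i) = Some i.
  by rewrite /inv; case: pickP => [j /eqP/Tinj->|/(_ i)] //; rewrite eqxx.
have invE x i : inv x = Some i -> T i = x.
  by rewrite /inv; case: pickP => // j /eqP Tj [<-].
(* The fibre over [y] is a product set: one prescribed value at each point of the image of [T], no
   constraint elsewhere. *)
pose Q x : pred bool := if inv x is Some i then pred1 (y i) else predT.
have -> : \sum_(z : {ffun J -> bool} | [ffun i => z (T i)] == y) prob t z =
    \sum_(z in family Q) \prod_x w (z x).
  apply: eq_bigl => z; apply/eqP/familyP => [E x|H].
    rewrite -[_ \in _]/(Q x (z x)) /Q; case xi: (inv x) => [i|//].
    by rewrite -E ffunE (invE _ _ xi) /= eqxx.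
  apply/ffunP => i; rewrite ffunE; have := H (T i).
  by rewrite -[_ \in _]/(Q (T i) (z (T i))) /Q invT /= => /eqP.
rewrite -(bigA_distr_big_dep _ (fun _ b => w b)).
rewrite (bigID [in codom T]) /= [X in _ * X]big1 ?mulr1; last first.
  move=> x xT; rewrite /Q; case xi: (inv x) => [i|].
    by case/negP: xT; rewrite -(invE _ _ xi) codom_f.
  by rewrite big_bool /w /=; ring.
rewrite -big_filter.
rewrite /prob.
have H : perm_eq [seq x <- index_enum J | x \in codom T] [seq T i | i <- index_enum I].
  apply: uniq_perm; first by rewrite filter_uniq // index_enum_uniq.
    by rewrite map_inj_uniq // index_enum_uniq.
  move=> x; rewrite mem_filter mem_index_enum andbT; apply/codomP/mapP => [[i ->]|[i _ ->]].
    by exists i; rewrite ?mem_index_enum.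
  by exists i.
rewrite (perm_big _ H) big_map; apply: eq_bigr => i _.
by rewrite /Q invT big_pred1_eq.
Qed.

(** Chebyshev's inequality: the mean of the sum is at least [#|K|%:R * mu] and its variance at most
    [M%:R * #|K|%:R]. *)
Lemma vote_error_le {R : realType} {I K : finType} (t mu : R) (M : nat)
  (f : K -> {ffun I -> bool} -> R) :
  0 <= t <= 1 -> 0 < mu -> (0 < #|K|)%N ->
  (forall i, exists2 D : {set K}, (#|D| <= M)%N &
     forall l, l \notin D -> indep i (f l)) ->
  (forall l z, `|f l z| <= 1) -> (forall l, mu <= Ex t (f l)) ->
  (\sum_(z | \sum_l f l z <= 0) prob t z) * (#|K|%:R * mu ^+ 2) <= M%:R.
Proof.
move=> t01 mu0 K0 Hf f1 fmu; set P := \sum_(z | _) _.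
have K0' : 0 < #|K|%:R :> R by rewrite ltr0n.
pose S z := \sum_l f l z; pose m := Ex t S.
have mE : m = \sum_l Ex t (f l) by rewrite /m /S (Ex_sum xpredT).
have m_ge : #|K|%:R * mu <= m.
  by rewrite mE mulr_natl -sumr_const; apply: ler_sum.
have := variance_sum_le t01 Hf (enum I).
have -> : Ex t (fun z => (\sum_l avgs t (enum I) (f l) z) ^+ 2) = m ^+ 2.
  rewrite -[RHS](Ex_const (I := I) t); apply: eq_Ex => z.
  by rewrite mE; congr (_ ^+ 2); apply: eq_bigr => l _; exact: avgs_enum.
have sq1 : \sum_l (Ex t (fun z => f l z ^+ 2) - Ex t (fun z => avgs t (enum I) (f l) z ^+ 2)) <= #|K|%:R.
  rewrite -[leRHS]mulr1 mulr_natl -sumr_const; apply: ler_sum => l _.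
  have : Ex t (fun z => f l z ^+ 2) <= 1.
    rewrite -(Ex_const (I := I) t 1); apply: ler_Ex => // z.
    by rewrite -real_normK ?num_real // exprn_ile1.
  have : 0 <= Ex t (fun z => avgs t (enum I) (f l) z ^+ 2).
    rewrite -(Ex_const (I := I) t 0); apply: ler_Ex => // z; exact: sqr_ge0.
  by lra.
move=> var; have {}var := le_trans var (ler_wpM2l (ler0n R M) sq1).
(* If [S z <= 0] then [S z] is at distance at least [m] from its mean [m]. *)
have cheb : P * m ^+ 2 <= Ex t (fun z => (S z) ^+ 2) - m ^+ 2.
  have -> : Ex t (fun z => (S z) ^+ 2) - m ^+ 2 = Ex t (fun z => (S z - m) ^+ 2).
    have -> : Ex t (fun z => (S z - m) ^+ 2) =
        Ex t (fun z => S z ^+ 2 - (2 * m) * S z + m ^+ 2).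
      by apply: eq_Ex => z; ring.
    by rewrite ExD ExB ExZ Ex_const -/m; ring.
  rewrite /P mulr_suml /Ex [leRHS](bigID (fun z => S z <= 0)) /=.
  rewrite -[leLHS]addr0 lerD //.
    apply: ler_sum => z Sz; apply: ler_wpM2l; first exact: prob_ge0.
    have m0 : 0 <= m by apply: le_trans m_ge; rewrite mulr_ge0 // ltW.
    have := mulr_ge0 m0 m0; move: Sz; rewrite -/(S z); nra.
  apply: sumr_ge0 => z _; rewrite mulr_ge0 ?sqr_ge0 //; exact: prob_ge0.
have P0 : 0 <= P by apply: sumr_ge0 => z _; exact: prob_ge0.
rewrite -(ler_pM2r K0').
apply: le_trans (le_trans cheb var).
rewrite -!mulrA; apply: ler_wpM2l => //.
have -> : #|K|%:R * (mu * (mu * #|K|%:R)) = (#|K|%:R * mu) ^+ 2 by ring.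
apply: lerXn2r; rewrite ?nnegrE ?mulr_ge0 // ?ltW //.
by apply: lt_le_trans m_ge; rewrite mulr_gt0.
Qed.

(** * Reed-Muller codes *)

Definition deg_le {m : nat} (r : nat) (f : point m -> bool) : Prop :=
  exists2 c : {ffun {set 'I_m} -> bool},
    forall S, c S -> (#|S| <= r)%N & forall x, f x = poly_eval c x.

Lemma deg_le_const {m : nat} r b : deg_le r (fun _ : point m => b).
Proof.
exists [ffun S => b && (S == finset.set0)].
  by move=> S; rewrite ffunE => /andP[_ /eqP->]; rewrite cards0.
move=> x; rewrite ffunE (bigD1 finset.set0) //= ffunE eqxx andbT big1.
  have -> : monomial finset.set0 x by apply/forallP => i; rewrite inE.
  by case: b.
by move=> S /negbTE S0; rewrite ffunE S0 andbF.
Qed.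

Lemma deg_leD {m : nat} r (f g : point m -> bool) :
  deg_le r f -> deg_le r g -> deg_le r (fun x => f x (+) g x).
Proof.
move=> [c cr cf] [d dr dg]; exists [ffun S => c S (+) d S].
  by move=> S; rewrite ffunE; case: (boolP (c S)) => [/cr//|_]; exact: dr.
move=> x; rewrite cf dg !ffunE -big_split /=; apply: eq_bigr => S _.
by rewrite ffunE andb_addl.
Qed.

Lemma deg_le_sum {m : nat} {K : finType} r (P : pred K) (f : K -> point m -> bool) :
  (forall k, P k -> deg_le r (f k)) ->
  deg_le r (fun x => \big[addb/false]_(k | P k) f k x).
Proof.
move=> fr; have H (s : seq K) : deg_le r (fun x => \big[addb/false]_(k <- s | P k) f k x).
  elim: s => [|k s [c cr cf]].
    by have [c cr cf] := deg_le_const (m := m) r false; exists c => // x; rewrite big_nil -cf.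
  case: (boolP (P k)) => [Pk|/negbTE nPk].
    have [d dr df] := deg_leD (fr _ Pk) (ex_intro2 _ _ c cr cf).
    by exists d => // x; rewrite big_cons Pk -df.
  by exists c => // x; rewrite big_cons nPk cf.
exact: H.
Qed.

Lemma deg_leM {m : nat} r (f : point m -> bool) b :
  deg_le r f -> deg_le r (fun x => b && f x).
Proof. by case: b => //= _; exact: deg_le_const. Qed.

Lemma deg_leS {m : nat} r (f : point m -> bool) : deg_le r f -> deg_le r.+1 f.
Proof. by move=> [c cr cf]; exists c => // S /cr /leqW. Qed.

Lemma monomialU1 {m : nat} (i : 'I_m) S (x : point m) :
  monomial (i |: S) x = x i && monomial S x.
Proof.
apply/forallP/andP => [H|[xi /forallP H] j].
  split; first by have /implyP := H i; apply; rewrite !inE eqxx.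
  by apply/forallP => j; apply/implyP => jS; have /implyP := H j; apply; rewrite !inE jS orbT.
by apply/implyP; rewrite !inE => /orP[/eqP->//|jS]; have /implyP := H j; apply.
Qed.

Lemma deg_le_coord {m : nat} r (f : point m -> bool) i :
  deg_le r f -> deg_le r.+1 (fun x => x i && f x).
Proof.
move=> [c cr cf].
(* Since [x i] is idempotent, the monomial of [T] becomes that of [i |: T]; two sets [T] can give
   the same [S], so their coefficients are added. *)
exists [ffun S : {set 'I_m} => \big[addb/false]_(T : {set 'I_m} | (i |: T) == S) c T].
  move=> S; rewrite ffunE => cS; apply: contraT; rewrite -ltnNge => rS.
  move: cS; rewrite big1 // => T /eqP E; apply/negP => /cr Tr.
  by move: rS; rewrite -E cardsU1 ltnNge -add1n leq_add // leq_b1.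
move=> x; rewrite cf !ffunE big_distrr /=.
rewrite (partition_big (fun T : {set 'I_m} => i |: T) xpredT) //=.
apply: eq_bigr => S _; rewrite ffunE big_distrl /=; apply: eq_bigr => T /eqP <-.
by rewrite monomialU1; case: (x i); case: (c T); case: (monomial T x).
Qed.

Definition affine {m n : nat} (T : point m -> point n) : Prop :=
  forall i, exists b (l : 'I_m -> bool), forall x,
    T x i = b (+) \big[addb/false]_j (l j && x j).

(** Substituting affine forms into a monomial multiplies as many affine forms as its degree, and
    each factor raises the degree by at most one. *)
Lemma deg_le_affine {m n : nat} r (T : point m -> point n) (f : point n -> bool) :
  affine T -> deg_le r f -> deg_le r (fun x => f (T x)).
Proof.
move=> HT [c cr cf].
have mon k : forall S : {set 'I_n}, #|S| = k -> deg_le k (fun x => monomial S (T x)).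
  elim: k => [|k IH] S.
    move=> /cards0_eq ->; have [d dr df] := deg_le_const (m := m) 0 true.
    by exists d => // x; rewrite -df; apply/forallP => i; rewrite inE.
  move=> Sk; have /card_gt0P[i iS] : (0 < #|S|)%N by rewrite Sk.
  have {}IH := IH (S :\ i); have {IH} := IH _.
  move: Sk; rewrite (cardsD1 i) iS /= => -[Sk] /(_ Sk) IH.
  have [b [l Tl]] := HT i.
  have H : deg_le k.+1 (fun x => (b && monomial (S :\ i) (T x)) (+)
     \big[addb/false]_j (l j && (x j && monomial (S :\ i) (T x)))).
    apply: deg_leD; first by apply: deg_leM; exact: deg_leS.
    by apply: deg_le_sum => j _; apply: deg_leM; exact: deg_le_coord.
  have [d dr df] := H; exists d => // x; rewrite -df -{1}(finset.setD1K iS) monomialU1 Tl.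
  rewrite andb_addl big_distrl /=; congr (_ (+) _).
  by apply: eq_bigr => j _; rewrite andbA.
have H : deg_le r (fun x => \big[addb/false]_(S : {set 'I_n} | c S) monomial S (T x)).
  apply: deg_le_sum => S cS; have [d dr df] := mon _ S erefl.
  by exists d => // U /dr dU; exact: leq_trans (cr _ cS).
have [d dr df] := H; exists d => // x; rewrite -df cf ffunE [RHS]big_mkcond /=.
by apply: eq_bigr => S _; case: (c S).
Qed.

Definition rmcode (m r : nat) : {set {ffun point m -> bool}} :=
  [set f : {ffun point m -> bool} | `[< deg_le r f >]].

Lemma rmcodeP {m r : nat} (f : {ffun point m -> bool}) :
  reflect (deg_le r f) (f \in rmcode m r).
Proof. by rewrite inE; exact: asboolP. Qed.

Lemma rmcode0 m r : [ffun=> false] \in rmcode m r.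
Proof.
by apply/rmcodeP; have [d dr df] := deg_le_const (m := m) r false; exists d => // x;
  rewrite ffunE -df.
Qed.

Lemma rmcodeD m r c d :
  c \in rmcode m r -> d \in rmcode m r -> vadd c d \in rmcode m r.
Proof.
move=> /rmcodeP c_r /rmcodeP d_r; apply/rmcodeP; have [e er ef] := deg_leD c_r d_r.
by exists e => // x; rewrite ffunE ef.
Qed.

Lemma card_sets_le m r : #|[set S : {set 'I_m} | #|S| <= r]%N| = binom_le m r.
Proof.
rewrite /binom_le -sum1_card.
rewrite (partition_big (fun S : {set 'I_m} => inord #|S| : 'I_r.+1) xpredT) //=.
apply: eq_bigr => i _; rewrite -[in RHS](card_ord m) -card_draws -sum1_card.
apply: eq_bigl => S; rewrite !inE; apply/andP/eqP => [[Sr /eqP <-]|E].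
  by rewrite inordK // ltnS.
by rewrite E -ltnS ltn_ord; split => //; apply/eqP/val_inj; rewrite /= inordK.
Qed.

Lemma card_rmcode m r : (#|rmcode m r| <= 2 ^ binom_le m r)%N.
Proof.
pose D := [set S : {set 'I_m} | #|S| <= r]%N.
pose A := [set c : {ffun {set 'I_m} -> bool} | c \in pffun_on false (mem D) predT].
have /subset_leq_card sub : rmcode m r \subset (@poly_eval m) @: A.
  apply/fintype.subsetP => f /rmcodeP[c cr cf]; apply/imsetP; exists c.
    rewrite inE; apply/pffun_onP; split => //.
    by apply/fintype.subsetP => S; rewrite !inE => cS; apply: cr; move: cS; case: (c S).
  by apply/ffunP => x; rewrite cf.
apply: leq_trans sub (leq_trans (leq_imset_card _ _) _).
by rewrite cardsE card_pffun_on card_bool -card_sets_le.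
Qed.

(** Evaluation is triangular for inclusion: at the indicator of [S] exactly the monomials of subsets
    of [S] equal 1, so coefficients are recovered by induction on [#|S|]. *)
Lemma poly_eval_inj m : injective (@poly_eval m).
Proof.
move=> c d E; apply/ffunP => S; have [n] := ubnP #|S|.
elim: n S => // n IH S Sn.
have /ffunP/(_ [ffun i => i \in S]) := E; rewrite !ffunE.
have mono (T : {set 'I_m}) : monomial T [ffun i => i \in S] = (T \subset S).
  apply/forallP/fintype.subsetP => H i; have := H i; rewrite ffunE; first by move/implyP.
  by move=> Hi; apply/implyP.
rewrite (bigD1 S) //= [in RHS](bigD1 S) //= mono fintype.subxx !andbT.
set a := \big[addb/false]_(_ | _) _; set b := \big[addb/false]_(_ | _) _.
have -> : a = b.
  apply: eq_bigr => T TS; rewrite mono; case: (boolP (T \subset S)) => [sub|]; last by rewrite !andbF.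
  rewrite IH //; apply: leq_trans (_ : #|S| <= n)%N => //.
  by apply: proper_card; rewrite finset.properEneq TS.
by move/(congr1 (addb^~ b)); rewrite -!addbA addbb !addbF.
Qed.

(** The default value in [coeffs] is never reached: [poly_eval] is injective between two sets of
    equal cardinality, hence surjective. *)
Lemma coeffsK m : cancel (@coeffs m) (@poly_eval m).
Proof.
move=> f; rewrite /coeffs; case: pickP => [c /eqP //|H].
have card_eq : #|{ffun {set 'I_m} -> bool}| = #|{ffun point m -> bool}|.
  rewrite !card_ffun; congr (_ ^ _)%N.
  rewrite -[LHS]cardsT -finset.powersetT card_powerset cardsT.
  by congr (_ ^ _)%N; rewrite -card_bool; apply: eq_card.
have [g gK Kg] := inj_card_bij (@poly_eval_inj m) (eq_leq (esym card_eq)).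
by have := H (g f); rewrite Kg eqxx.
Qed.

(** * Boosting along graphs of linear maps *)

Definition dot {n : nat} (l v : point n) : bool :=
  \big[addb/false]_a (l a && v a).

Lemma dotDr {n : nat} (l v w : point n) : dot l (vadd v w) = dot l v (+) dot l w.
Proof.
rewrite /dot -big_split /=; apply: eq_bigr => a _.
by rewrite ffunE andb_addr.
Qed.

Lemma dotDl {n : nat} (l k v : point n) : dot (vadd l k) v = dot l v (+) dot k v.
Proof.
rewrite /dot -big_split /=; apply: eq_bigr => a _.
by rewrite ffunE andb_addl.
Qed.

Lemma dot0 {n : nat} (l : point n) : dot l [ffun=> false] = false.
Proof. by rewrite /dot big1 // => a _; rewrite ffunE andbF. Qed.

Lemma dot_delta {n : nat} (a : 'I_n) s (v : point n) :
  dot [ffun a' => (a' == a) && s] v = s && v a.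
Proof.
rewrite /dot (bigD1 a) //= ffunE eqxx /= big1 ?addbF // => b /negbTE ba.
by rewrite ffunE ba.
Qed.

(* The affine embedding whose image is the translate through [x0] of the graph
   of [L]; it sends [i0] to [x0]. *)
Definition emb {n k : nat} (x0 : point (n + k)) (i0 : point n)
    (L : {ffun 'I_k -> point n}) (v : point n) : point (n + k) :=
  [ffun j => x0 j (+) match fintype.split j with
                      | inl a => vadd v i0 a
                      | inr b => dot (L b) (vadd v i0)
                      end].

Lemma emb_lshift {n k : nat} (x0 : point (n + k)) i0 L v a :
  emb x0 i0 L v (lshift k a) = x0 (lshift k a) (+) vadd v i0 a.
Proof.
rewrite ffunE; case: (split_ordP (lshift k a)) => [a' /lshift_inj <- //|b /eqP].
by rewrite eq_lrshift.
Qed.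

Lemma emb_rshift {n k : nat} (x0 : point (n + k)) i0 L v b :
  emb x0 i0 L v (rshift n b) = x0 (rshift n b) (+) dot (L b) (vadd v i0).
Proof.
rewrite ffunE; case: (split_ordP (rshift n b)) => [a' /eqP|b' /rshift_inj <- //].
by rewrite eq_rlshift.
Qed.

Lemma emb_base {n k : nat} (x0 : point (n + k)) i0 L : emb x0 i0 L i0 = x0.
Proof.
have v0 : vadd i0 i0 = [ffun=> false] by apply/ffunP => a; rewrite !ffunE addbb.
apply/ffunP => j; rewrite ffunE v0; case: (fintype.split j) => a.
  by rewrite ffunE addbF.
by rewrite dot0 addbF.
Qed.

Lemma emb_inj {n k : nat} (x0 : point (n + k)) i0 L : injective (emb x0 i0 L).
Proof.
move=> v w /ffunP E; apply/ffunP => a; have := E (lshift k a).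
by rewrite !emb_lshift !ffunE => /addbI /addIb.
Qed.

Lemma emb_affine {n k : nat} (x0 : point (n + k)) i0 L : affine (emb x0 i0 L).
Proof.
move=> j; case: (split_ordP j) => [a ->|b ->].
  exists (x0 (lshift k a) (+) i0 a), (fun a' => (a' == a) && true) => v.
  rewrite emb_lshift ffunE; have := dot_delta a true v.
  rewrite /dot; under eq_bigr do rewrite ffunE.
  by move=> ->; rewrite /= [v a (+) _]addbC addbA.
exists (x0 (rshift n b) (+) dot (L b) i0), (L b) => v.
by rewrite emb_rshift dotDr [dot _ v (+) _]addbC addbA.
Qed.

(** The base point lies on every graph; it is given the empty set, because the estimator on each
    graph ignores the coordinate [i0] that is sent to [x0]. *)
Definition emb_through {n k : nat} (x0 : point (n + k)) i0 (x : point (n + k)) :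
    {set {ffun 'I_k -> point n}} :=
  [set L | (x != x0) && [exists v, emb x0 i0 L v == x]].

(* Adding multiples of a fixed covector to the rows of [L] moves the value of
   [L] at a nonzero vector over all of F_2^k. *)
Lemma card_emb_through {n k : nat} (x0 : point (n + k)) i0 x :
  (#|emb_through x0 i0 x| * 2 ^ k <= #|{ffun 'I_k -> point n}|)%N.
Proof.
set D := emb_through x0 i0 x.
have [D0|/card_gt0P [L0 L0D]] := posnP #|D|; first by rewrite D0.
pose u : point n := [ffun a => x0 (lshift k a) (+) x (lshift k a)].
have DP L : L \in D -> forall b, dot (L b) u = x0 (rshift n b) (+) x (rshift n b).
  rewrite inE => /andP[_ /existsP[v /eqP Ev]] b.
  have -> : u = vadd v i0.
    by apply/ffunP => a; rewrite [LHS]ffunE -Ev emb_lshift addbA addbb addFb.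
  by rewrite -Ev emb_rshift addbA addbb addFb.
(* If [u] were zero, [x] and [x0] would agree on the first [n] coordinates, and then, through [L0],
   on the last [k] as well. *)
have [a ua] : exists a, u a.
  apply/existsP; apply: contraT; rewrite negb_exists => /forallP u0.
  have u00 : u = [ffun=> false] by apply/ffunP => a; rewrite [RHS]ffunE; apply/negbTE.
  move: (L0D); rewrite inE => /andP[/eqP xx0 _]; case: xx0.
  have xorE (a b : bool) : a (+) b = false -> b = a by case: a b => [] [].
  apply/ffunP => j; apply: xorE.
  case: (split_ordP j) => [a ->|b ->].
    by move/ffunP/(_ a): u00; rewrite !ffunE => ->.
  by have := DP _ L0D b; rewrite u00 dot0 => <-.
(* Row [b] receives [p.1 b] times the coordinate covector at [a]; as [u a] holds, its value at [u]
   changes by [p.1 b], so the shift can be read off. *)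
pose shift (p : {ffun 'I_k -> bool} * {ffun 'I_k -> point n}) :
    {ffun 'I_k -> point n} :=
  [ffun b => vadd (p.2 b) [ffun a' => (a' == a) && p.1 b]].
have shift_inj : {in finset.setX [set: {ffun 'I_k -> bool}]%SET D &, injective shift}.
  move=> [s L] [s' L']; rewrite !inE /= => LD LD' /ffunP E.
  have ss' : s = s'.
    apply/ffunP => b; have := congr1 (dot^~ u) (E b); rewrite !ffunE /= !dotDl.
    rewrite !dot_delta ua !andbT (DP L) ?inE // (DP L') ?inE //; exact: addbI.
  rewrite -ss' in E *; congr (_, _); apply/ffunP => b.
  have := E b; rewrite !ffunE /= => /(congr1 (fun w => vadd w [ffun a' => (a' == a) && s b])).
  by rewrite !vaddK.
have := max_card (mem (shift @: finset.setX [set: {ffun 'I_k -> bool}]%SET D)).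
rewrite (card_in_imset shift_inj) cardsX cardsT card_ffun card_bool card_ord.
by rewrite mulnC.
Qed.

Definition sees {n k : nat} (x0 : point (n + k)) i0 (L : {ffun 'I_k -> point n})
    (z : {ffun point (n + k) -> bool}) : {ffun point n -> bool} :=
  [ffun v => z (emb x0 i0 L v)].

Lemma sees_rmcode {n k r : nat} (x0 : point (n + k)) i0 L c :
  c \in rmcode (n + k) r -> sees x0 i0 L c \in rmcode n r.
Proof.
move=> /rmcodeP/(deg_le_affine (emb_affine x0 i0 L))[d dr df].
by apply/rmcodeP; exists d => // v; rewrite ffunE df.
Qed.

(** The votes are copies of one weak estimator, one on each graph through [x0]. Every graph sends
    [i0] to [x0], so all votes change sign with the same bit [c x0]. *)
Lemma exists_strong_estimator {R : realType} (t eta : R) (n k r : nat) :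
  0 < t < 1 / 2 -> 0 < eta ->
  (2 ^+ n) * eta <= 2 ^+ n * (ln 2 - hnat t) - (binom_le n r)%:R * ln 2 ->
  forall x0 : point (n + k), exists g : {ffun point (n + k) -> bool} -> R,
    (forall c z, c \in rmcode (n + k) r -> g (vadd z c) = (-1) ^+ (c x0) * g z) /\
    (\sum_(z | g z <= 0) prob t z) * eta ^+ 2 <= (2 ^+ k)^-1.
Proof.
move=> t01 eta0 Heta x0.
have cardI : #|point n| = (2 ^ n)%N by rewrite card_ffun card_bool card_ord.
have C0 : (0 < #|rmcode n r|)%N.
  by apply/card_gt0P; exists [ffun=> false]; exact: rmcode0.
have I0 : (0 < #|point n|)%N by rewrite cardI expn_gt0.
have Heta' : #|point n|%:R * eta <=
    #|point n|%:R * (ln 2 - hnat t) - ln (#|rmcode n r|%:R).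
  rewrite cardI natrX; apply: le_trans Heta _; rewrite lerD2l lerN2.
  rewrite mulr_natl -lnXn // ler_ln ?posrE ?ltr0n ?exprn_gt0 //.
  by rewrite -natrX ler_nat card_rmcode.
have [i0 [phi [phi_i0 phi1 phiC phiE]]] := exists_weak_estimator t01 I0
    (rmcode0 n r) (@rmcodeD n r) (ltW eta0) Heta'.
pose f L z := phi (sees x0 i0 L z).
exists (fun z => \sum_L f L z); split.
  move=> c z cC; rewrite mulr_sumr; apply: eq_bigr => L _; rewrite /f.
  have -> : sees x0 i0 L (vadd z c) = vadd (sees x0 i0 L z) (sees x0 i0 L c).
    by apply/ffunP => v; rewrite !ffunE.
  rewrite phiC; last exact: sees_rmcode.
  by rewrite [sees _ _ _ _ _]ffunE emb_base.
pose K := {ffun 'I_k -> point n}.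
have K0 : (0 < #|{: K}|)%N by apply/card_gt0P; exists [ffun=> [ffun=> false]].
have k0 : (0 < 2 ^ k)%N by rewrite expn_gt0.
have := @vote_error_le R _ K t eta (#|{: K}| %/ 2 ^ k) f _ eta0 K0 _ _ _.
have K0' : 0 < #|{: K}|%:R :> R by rewrite ltr0n.
have M_le : (#|{: K}| %/ 2 ^ k)%:R <= #|{: K}|%:R / 2 ^+ k :> R.
  by rewrite ler_pdivlMr ?exprn_gt0 // -natrX -natrM ler_nat leq_divM.
move=> vote; rewrite -(ler_pM2l K0') mulrCA.
apply: le_trans M_le; apply: vote.
- by lra.
- move=> x; exists (emb_through x0 i0 x).
    by rewrite leq_divRL // card_emb_through.
  move=> L; rewrite inE negb_and negbK => LD z b; rewrite /f.
  (* Changing the noise at [x0] changes every restriction only at [i0], which [phi] ignores. *)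
  case: (eqVneq x x0) LD => [-> _|xx0 /= /existsPn Lx].
    rewrite -(phi_i0 (sees x0 i0 L z) b); congr phi; apply/ffunP => v.
    rewrite [LHS]ffunE [LHS]ffunE [RHS]ffunE [sees _ _ _ _ _]ffunE.
    by rewrite -{2}(emb_base x0 i0 L) (inj_eq (@emb_inj _ _ _ _ _)).
  congr phi; apply/ffunP => v; rewrite [LHS]ffunE [LHS]ffunE [RHS]ffunE.
  by rewrite (negbTE (Lx v)).
- by move=> L z; exact: phi1.
- by move=> L; rewrite /f (Ex_pullback t phi (@emb_inj _ _ x0 i0 L)).
Qed.

(** * Entropy of the noise given its syndrome *)

Lemma ln2_gt0 {R : realType} : 0 < ln 2 :> R.
Proof. by rewrite ln_gt0 // ltr1n. Qed.

(* Gibbs' inequality with the subprobability kernel [Q] as reference. *)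
Lemma cond_entropy_le {R : realType} {T A B : finType} (p Q : T -> R)
    (X : T -> A) (Y : T -> B) :
  (forall t, 0 < p t) -> (forall t, 0 < Q t) ->
  injective (fun t => (X t, Y t)) ->
  (forall b, \sum_(t | Y t == b) Q t <= 1) ->
  cond_entropy p X Y <= - \sum_t p t * log2 (Q t).
Proof.
move=> p0 Q0 XYinj Q1.
pose pY b := \sum_(t | Y t == b) p t.
have pY0 t : 0 < pY (Y t).
  rewrite /pY (bigD1 t) //= ltr_pwDl // sumr_ge0 // => s _; exact: ltW.
(* By injectivity each cell of the pair of [X] and [Y] holds at most one outcome; empty cells fall
   in the zero branch. *)
have -> : cond_entropy p X Y = - \sum_t p t * log2 (p t / pY (Y t)).
  rewrite /cond_entropy; congr (- _).
  rewrite [RHS](partition_big X xpredT) //=; apply: eq_bigr => a _.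
  rewrite [RHS](partition_big Y xpredT) //=; apply: eq_bigr => b _.
  case: (pickP (fun t => (X t == a) && (Y t == b))) => [t /andP[/eqP Xt /eqP Yt]|none].
    have E s : (X s == a) && (Y s == b) = (s == t).
      apply/andP/eqP => [[/eqP Xs /eqP Ys]|->]; last by rewrite Xt Yt.
      by apply: XYinj; rewrite Xs Ys Xt Yt.
    by rewrite !(eq_bigl _ _ E) !big_pred1_eq gt_eqF // -/(pY b) Yt.
  by rewrite (big_pred0 _ _ _ _ none) eqxx big_pred0.
rewrite lerN2 -subr_ge0 -sumrB.
have E t : p t * log2 (p t / pY (Y t)) - p t * log2 (Q t) =
    - (p t * ln (Q t * pY (Y t) / p t)) / ln 2.
  rewrite /log2 !ln_div ?lnM ?posrE ?mulr_gt0 //.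
  by field; rewrite gt_eqF // ln2_gt0.
rewrite (eq_bigr _ (fun t _ => E t)) -mulr_suml sumrN mulr_ge0 //; last first.
  by rewrite invr_ge0 ltW // ln2_gt0.
rewrite oppr_ge0; apply: (@le_trans _ _ (\sum_t (Q t * pY (Y t) - p t))).
  apply: ler_sum => t _.
  apply: le_trans (ler_wpM2l (ltW (p0 t)) (ln_le_sub1 _)) _.
    by rewrite divr_gt0 // mulr_gt0.
  by rewrite mulrBr mulr1 mulrC divfK // gt_eqF.
(* On each fibre of [Y] the weight [pY] is constant and [Q] has mass at most 1, so the sum of
   [Q t * pY (Y t)] is at most that of [p]. *)
rewrite sumrB subr_le0 (partition_big Y xpredT) //= [leRHS](partition_big Y xpredT) //=.
apply: ler_sum => b _; rewrite -/(pY b).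
rewrite (eq_bigr (fun t => Q t * pY b)) => [|t /eqP <- //].
rewrite -mulr_suml ler_piMl //; first by apply: sumr_ge0 => t _; exact: ltW.
Qed.

Lemma W_split m r (z : {ffun point m -> bool}) :
  vadd (W_le r z) (W_gt r z) = coeffs z.
Proof.
apply/ffunP => S; rewrite !ffunE ltnNge.
by case: (_ <= _)%N => //=; rewrite addbF.
Qed.

Lemma poly_eval_vadd m (c d : {ffun {set 'I_m} -> bool}) :
  poly_eval (vadd c d) = vadd (poly_eval c) (poly_eval d).
Proof.
apply/ffunP => x; rewrite !ffunE -big_split /=; apply: eq_bigr => S _.
by rewrite ffunE andb_addl.
Qed.

(** [W_gt] gives the noise up to a codeword of degree at most [r]; decoding that word with [g]
    guesses each noise bit with error at most [s ^+ 2]. Gibbs' inequality is applied with the kernel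
    of independent bits around these guesses. *)
Lemma a_mr_le {R : realType} (t s : R) (m r : nat)
    (g : point m -> {ffun point m -> bool} -> R) :
  0 < t < 1 -> 0 < s <= 1 / 2 ->
  (forall x c z, c \in rmcode m r -> g x (vadd z c) = (-1) ^+ (c x) * g x z) ->
  (forall x, \sum_(z | g x z <= 0) prob t z <= s ^+ 2) ->
  a_mr t m r <= 2 ^+ m * (4 * s / ln 2).
Proof.
move=> t01 s01 gC gerr.
pose high (z : {ffun point m -> bool}) := poly_eval (W_gt r z).
(* When [g x z] is positive, the sign of [g x] on the high part reveals the value at [x] of the low
   part, by [gC]. *)
pose guess b x := poly_eval b x (+) (g x (poly_eval b) < 0).
have low z : poly_eval (W_le r z) \in rmcode m r.
  apply/rmcodeP; exists (W_le r z) => // S; rewrite ffunE; by case/andP.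
have zE z : z = vadd (high z) (poly_eval (W_le r z)).
  by rewrite vaddC -poly_eval_vadd W_split coeffsK.
have guess_ok z x : 0 < g x z -> guess (W_gt r z) x = z x.
  rewrite [in g x z](zE z) gC // /guess -/(high z) => g0.
  rewrite [in RHS](zE z) [RHS]ffunE; congr (_ (+) _).
  by move: g0; case: (_ x); rewrite ?expr0 ?expr1 ?mul1r ?mulN1r ?oppr_gt0 => // /ltW;
    rewrite leNgt => /negbTE.
pose e := s ^+ 2.
have e0 : 0 < e by rewrite exprn_gt0; lra.
have e1 : e <= s / 2 by rewrite /e; nra.
pose w (b b' : bool) : R := if b == b' then 1 - e else e.
have w0 b b' : 0 < w b b' by rewrite /w; case: ifP => _; lra.
pose Q z := \prod_x w (guess (W_gt r z) x) (z x).
have Q0 z : 0 < Q z by apply: prodr_gt0.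
apply: (@le_trans _ _ (- \sum_z prob t z * log2 (Q z))).
  rewrite /a_mr; apply: (cond_entropy_le (p := prob t) (Q := Q)) => //.
  - by move=> z; exact: prob_gt0.
  - move=> z z' /= [E1 E2]; rewrite -(coeffsK z) -(coeffsK z').
    by rewrite -(W_split r z) -(W_split r z') E1 E2.
  (* For a fixed value [b] of [W_gt], [Q] is the restriction of a product probability to the
     fibre. *)
  move=> b; rewrite -(@sum_prob_fun R (point m) (fun x => w (guess b x))); last first.
    by move=> x; rewrite /w; case: (guess b x) => /=; ring.
  rewrite [leRHS](bigID (fun z => W_gt r z == b)) /= -[leLHS]addr0 lerD //.
    by apply: ler_sum => z /eqP <-.
  by apply: sumr_ge0 => z _; apply: prodr_ge0 => x _; exact: ltW.
have -> : - \sum_z prob t z * log2 (Q z) =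
    \sum_(x : point m) \sum_z prob t z * (- ln (w (guess (W_gt r z) x) (z x)) / ln 2).
  rewrite exchange_big -sumrN /=; apply: eq_bigr => z _.
  rewrite -mulr_sumr -mulrN; congr (_ * _).
  by rewrite /log2 ln_prod // mulr_suml -sumrN; apply: eq_bigr => x _; rewrite mulNr.
have -> : 2 ^+ m * (4 * s / ln 2) = \sum_(x : point m) (4 * s / ln 2).
  by rewrite sumr_const card_ffun card_bool card_ord -[RHS]mulr_natl natrX.
apply: ler_sum => x _.
have l2 := @ln2_gt0 R.
(* This is [- ln s <= s^-1 - 1] times [2 * s ^+ 2]; writing the error as a square makes its entropy
   cost linear in [s]. *)
have ln_e : e * - ln e <= 2 * s.
  have := ln_le_sub1 (_ : 0 < s^-1); rewrite invr_gt0 lnV ?posrE; last by lra.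
  have s0 : 0 < s by lra.
  move=> /(_ s0) H; rewrite /e lnXn // -mulr_natl.
  have : s * (s * (- ln s)) <= s * (s * (s^-1 - 1)).
    by apply: ler_wpM2l; [lra|]; apply: ler_wpM2l; [lra|].
  rewrite mulrBr divff ?gt_eqF // => H'.
  have := mulr_ge0 (ltW s0) (ltW s0); move: H'; nra.
have ln_1e : - ln (1 - e) <= 2 * e.
  have e1' : 0 < 1 - e by lra.
  rewrite -lnV ?posrE //; apply: le_trans (ln_le_sub1 _) _; first by rewrite invr_gt0.
  have -> : (1 - e)^-1 - 1 = e / (1 - e) by field; lra.
  by rewrite ler_pdivrMr //; nra.
have ln_e0 : 0 <= - ln e by rewrite oppr_ge0 ln_le0 //; lra.
have ln_1e0 : 0 <= - ln (1 - e) by rewrite oppr_ge0 ln_le0 //; lra.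
(* A wrong guess costs [- ln e] and a right one [- ln (1 - e)]; the latter is charged on every
   word. *)
apply: (@le_trans _ _ (((\sum_(z | g x z <= 0) prob t z) * - ln e +
    (\sum_(z : {ffun point m -> bool}) prob t z) * - ln (1 - e)) / ln 2)).
  rewrite mulrDl !mulr_suml [leLHS](bigID (fun z => g x z <= 0)) /=.
  rewrite [X in _ <= _ + X](bigID (fun z => g x z <= 0)) /= addrA; apply: lerD.
    rewrite -big_split /=; apply: ler_sum => z _.
    rewrite -!mulrA -mulrDr; apply: ler_wpM2l; first by apply: prob_ge0; lra.
    by rewrite -mulrDl ler_pM2r ?invr_gt0 // /w; case: ifP => _; lra.
  apply: ler_sum => z; rewrite -ltNge => gz.
  by rewrite (guess_ok _ _ gz) /w eqxx mulrA.
rewrite ler_pM2r ?invr_gt0 // sum_prob mul1r.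
have : (\sum_(z | g x z <= 0) prob t z) * - ln e <= e * - ln e.
  by apply: ler_wpM2r => //; exact: gerr.
lra.
Qed.

(** * Rates *)

Lemma bin_le_succ n i : (i.+1 <= n - i)%N -> ('C(n, i) <= 'C(n, i.+1))%N.
Proof.
move=> H; rewrite -(@leq_pmul2l i.+1) // mul_bin_left leq_mul2r; apply/orP; right.
exact: H.
Qed.

Lemma bin_le_half n i : ('C(n, i) <= 'C(n, n./2))%N.
Proof.
have low j : (j <= n./2)%N -> ('C(n, n./2 - j) <= 'C(n, n./2))%N.
  elim: j => [|j IH] jn; first by rewrite subn0.
  apply: leq_trans (IH (ltnW jn)).
  have -> : (n./2 - j = (n./2 - j.+1).+1)%N by lia.
  by apply: bin_le_succ; lia.
have low' j : (j <= n./2)%N -> ('C(n, j) <= 'C(n, n./2))%N.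
  by move=> jn; have := low (n./2 - j)%N; rewrite subKn //; apply; lia.
case: (leqP i n./2) => [|ni]; first exact: low'.
case: (leqP i n) => [in'|/bin_small -> //].
by rewrite -bin_sub //; apply: low'; lia.
Qed.

(** Induction through [(j + 1) C(2j + 2, j + 1) = 2 (2j + 1) C(2j, j)] and
    [(2j + 3) (2j + 1) <= 4 (j + 1)^2]. *)
Lemma central_bin_le j : ((2 * j).+1 * 'C(2 * j, j) ^ 2 <= 16 ^ j)%N.
Proof.
elim: j => [//|j IH].
have E : (j.+1 * 'C(2 * j.+1, j.+1) = 2 * (2 * j).+1 * 'C(2 * j, j))%N.
  have E1 := mul_bin_diag (2 * j.+1) j.
  have E2 := mul_bin_down (2 * j).+1 j.
  have e1 : (2 * j.+1).-1 = (2 * j).+1 by lia.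
  have e2 : ((2 * j).+1 - j = j.+1)%N by lia.
  rewrite e1 in E1; rewrite /= e2 in E2.
  by apply/eqP; rewrite -E1 -(eqn_pmul2l (ltn0Sn j)); apply/eqP; nia.
set A := 'C(2 * j, j) in IH E *; set B := 'C(2 * j.+1, j.+1) in E *.
rewrite -(@leq_pmul2l (j.+1 ^ 2)) ?expn_gt0 //.
have -> : (j.+1 ^ 2 * ((2 * j.+1).+1 * B ^ 2) = (2 * j.+1).+1 * (j.+1 * B) ^ 2)%N.
  by rewrite expnMn; ring.
rewrite E.
have -> : ((2 * j.+1).+1 * (2 * (2 * j).+1 * A) ^ 2 =
   4 * ((2 * j.+1).+1 * (2 * j).+1) * ((2 * j).+1 * A ^ 2))%N by ring.
rewrite [(16 ^ _)%N]expnS [X in (_ <= X)%N]mulnA; apply: leq_mul => //.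
by rewrite -mulnn; nia.
Qed.

Lemma bin_sqr_le n i : (n.+1 * 'C(n, i) ^ 2 <= 4 ^ n)%N.
Proof.
apply: (@leq_trans (n.+1 * 'C(n, n./2) ^ 2)).
  by rewrite leq_mul2l leq_sqr bin_le_half orbT.
have := odd_double_half n; set j := n./2; case: (odd n) => /= <-.
  (* For odd [n] the middle coefficient is half of the next central one. *)
  have H := central_bin_le j.+1.
  have E : 'C(2 * j.+1, j.+1) = (2 * 'C(1 + j.*2, j))%N.
    have -> : (2 * j.+1 = (1 + j.*2).+1)%N by lia.
    rewrite binS -(@bin_sub (1 + j.*2) j); last by lia.
    have -> : (1 + j.*2 - j = j.+1)%N by lia.
    by lia.
  rewrite E in H; set A := 'C(_, _) in H *.
  have -> : (4 ^ (1 + j.*2) = 4 * 16 ^ j)%N.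
    by rewrite expnS -mul2n expnM.
  by move: H; rewrite expnMn [(16 ^ j.+1)%N]expnS; set a := (A ^ 2)%N; set X := (16 ^ j)%N; nia.
rewrite add0n -mul2n; apply: leq_trans (central_bin_le j) _.
by rewrite expnM.
Qed.

Lemma bin_div_le {R : realType} n i :
  'C(n, i)%:R / 2 ^+ n <= (Num.sqrt n.+1%:R)^-1 :> R.
Proof.
have s0 : 0 < Num.sqrt n.+1%:R :> R by rewrite sqrtr_gt0.
rewrite ler_pdivrMr ?exprn_gt0 // ler_pdivlMl //.
rewrite -(@ler_pXn2r _ 2) ?nnegrE ?mulr_ge0 ?exprn_ge0 ?sqrtr_ge0 //.
rewrite exprMn sqr_sqrtr // -exprM mulnC exprM -!natrX -natrM ler_nat.
exact: bin_sqr_le.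
Qed.

Definition rate {R : realType} (m r : nat) : R := (binom_le m r)%:R / 2 ^+ m.

(** Pascal's rule summed up to [r]: the two partial sums it produces differ by the top term
    ['C(m, r)]. *)
Lemma binom_leS m r : (binom_le m.+1 r + 'C(m, r) = 2 * binom_le m r)%N.
Proof.
rewrite /binom_le; elim: r => [|r IH]; first by rewrite !big_ord1 !bin0.
rewrite big_ord_recr [in RHS]big_ord_recr /= mulnDr -IH binS.
by set s := (\sum_(_ < _) _)%N; lia.
Qed.

Lemma rateS {R : realType} m r :
  rate m r = rate m.+1 r + 'C(m, r)%:R / 2 ^+ m / 2 :> R.
Proof.
have := congr1 (fun n => n%:R : R) (binom_leS m r); rewrite natrD natrM => E.
have p0 : 2 ^+ m != 0 :> R by rewrite gt_eqF // exprn_gt0.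
rewrite /rate exprS.
have -> : (binom_le m r)%:R = ((binom_le m.+1 r)%:R + 'C(m, r)%:R) / 2 :> R by lra.
by field.
Qed.

(** Each added variable lowers the rate by half a normalised binomial coefficient, hence by at most
    [1 / (2 sqrt(n + 1))]. *)
Lemma rate_shift {R : realType} n k r :
  rate n r <= rate (n + k) r + k%:R / (2 * Num.sqrt n.+1%:R) :> R.
Proof.
elim: k => [|k IH]; first by rewrite addn0 mul0r addr0.
apply: le_trans IH _; rewrite addnS rateS -addrA lerD2l.
have s0 : Num.sqrt n.+1%:R != 0 :> R by rewrite gt_eqF // sqrtr_gt0.
have -> : k.+1%:R / (2 * Num.sqrt n.+1%:R) =
    (Num.sqrt n.+1%:R)^-1 / 2 + k%:R / (2 * Num.sqrt n.+1%:R) :> R.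
  by rewrite -[k.+1%:R]natr1; field.
rewrite lerD2r ler_pM2r ?invr_gt0 //.
apply: le_trans (bin_div_le _ _) _.
rewrite lef_pV2 ?posrE ?sqrtr_gt0 // ler_sqrt // ler_nat; lia.
Qed.

(** The largest radius with rate at most [L] works: one more layer overshoots [L] and weighs at most
    [1 / sqrt(m + 1)]. The assumption [1 <= L * 2 ^+ m] makes radius 0 admissible. *)
Lemma exists_radius {R : realType} (L : R) m : 0 < L < 1 -> 1 <= L * 2 ^+ m ->
  exists2 r, (r <= m)%N &
    L - (Num.sqrt m.+1%:R)^-1 <= rate m r <= L.
Proof.
move=> L01 Lm.
have p0 : 0 < 2 ^+ m :> R by rewrite exprn_gt0.
pose P r := rate m r <= L.
have P0 : exists r, P r.
  exists 0; rewrite /P /rate /binom_le big_ord1 bin0 ler_pdivrMr //.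
have full r : (m <= r)%N -> rate m r = 1 :> R.
  move=> mr; suff E : binom_le m r = (2 ^ m)%N by rewrite /rate E natrX divff // gt_eqF.
  elim: r mr => [|r IH]; rewrite leq_eqVlt.
    by rewrite orbF => /eqP->; rewrite /binom_le big_ord1.
  rewrite ltnS => /orP[/eqP <-|mr].
    have -> : (2 ^ m = (1 + 1) ^ m)%N by [].
    rewrite expnDn; apply: eq_bigr => i _.
    by rewrite !exp1n !muln1.
  by rewrite /binom_le big_ord_recr /= -/(binom_le m r) IH // bin_small ?addn0.
have Pm r : P r -> (r <= m)%N.
  rewrite /P; apply: contraLR; rewrite -!ltNge -ltnNge => mr.
  by rewrite full ?(ltnW mr) //; lra.
case: (ex_maxnP P0 Pm) => r Pr rmax; exists r; first exact: Pm.
rewrite [X in _ && X]Pr andbT.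
have : ~~ P r.+1 by apply/negP => /rmax; rewrite ltnn.
rewrite /P -ltNge.
have -> : rate m r.+1 = rate m r + 'C(m, r.+1)%:R / 2 ^+ m :> R.
  by rewrite /rate /binom_le big_ord_recr /= natrD mulrDl.
by have := @bin_div_le R m r.+1; lra.
Qed.

(** * Bounds on the binary entropy *)

Lemma hbinE {R : realType} (t : R) : hbin t = hnat t / ln 2.
Proof. by rewrite /hbin /hnat /log2; ring. Qed.

Lemma hbin_ge0 {R : realType} (t : R) : 0 < t < 1 -> 0 <= hbin t.
Proof.
move=> t01; rewrite hbinE divr_ge0 ?(ltW ln2_gt0) // /hnat.
have l1 : ln t <= 0 by apply: ln_le0; lra.
have l2 : ln (1 - t) <= 0 by apply: ln_le0; lra.
by nra.
Qed.

Lemma ln_lt_sub1 {R : realType} (x : R) : 0 < x -> x != 1 -> ln x < x - 1.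
Proof.
move=> x0 x1; rewrite -ltr_expR lnK ?posrE //.
have -> : x = 1 + (x - 1) by ring.
have -> : 1 + (x - 1) - 1 = x - 1 by ring.
by apply: expR_gt1Dx; rewrite subr_eq0.
Qed.

(** The relative entropy of a [t]-coin to a fair coin is positive: weighted by [t] and [1 - t], the
    two bounds [ln y <= y - 1] have right-hand sides summing to 0, and the first is strict since [t]
    is not 1/2. *)
Lemma hbin_lt1 {R : realType} (t : R) : 0 < t < 1 / 2 -> hbin t < 1.
Proof.
move=> t01; have t0 : 0 < t by lra.
rewrite hbinE ltr_pdivrMr ?ln2_gt0 // mul1r /hnat.
have tt0 : 0 < 1 - t by lra.
have H1 : ln (1 / (2 * t)) < 1 / (2 * t) - 1.
  apply: ln_lt_sub1; first by rewrite divr_gt0 // mulr_gt0.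
  by apply/eqP => E; have : 1 = 2 * t; [rewrite -[RHS]mul1r -E; field; lra | lra].
have H2 : ln (1 / (2 * (1 - t))) <= 1 / (2 * (1 - t)) - 1.
  by apply: ln_le_sub1; rewrite divr_gt0 // mulr_gt0.
move: H1 H2; rewrite !ln_div ?lnM ?posrE ?mulr_gt0 // ln1 !sub0r.
rewrite -(ltr_pM2l t0) -(ler_pM2l tt0).
have -> : t * (1 / (2 * t) - 1) = 1 / 2 - t by field; lra.
have -> : (1 - t) * (1 / (2 * (1 - t)) - 1) = 1 / 2 - (1 - t) by field; lra.
lra.
Qed.

(** * Boosted entropy bound and choice of the parameters *)

Lemma a_mr_boost {R : realType} (t eta s : R) (n k r : nat) :
  0 < t < 1 / 2 -> 0 < eta ->
  2 ^+ n * eta <= 2 ^+ n * (ln 2 - hnat t) - (binom_le n r)%:R * ln 2 ->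
  0 < s <= 1 / 2 -> s ^+ 2 * eta ^+ 2 = (2 ^+ k)^-1 ->
  a_mr t (n + k) r <= 2 ^+ (n + k) * (4 * s / ln 2).
Proof.
move=> t01 eta0 Heta s01 sE.
have [g gP] := choice (@exists_strong_estimator R t eta n k r t01 eta0 Heta).
apply: (a_mr_le (g := g)) => //; first by lra.
  by move=> x c z cC; rewrite (gP x).1.
by move=> x; rewrite -(@ler_pM2r _ (eta ^+ 2)) ?exprn_gt0 // sE; exact: (gP x).2.
Qed.

Lemma near_sqrt_ge {R : realType} (A : R) :
  (\forall m \near \oo, A <= Num.sqrt m%:R)%classic.
Proof.
near=> m; apply: le_trans (ler_norm A) _; rewrite -sqrtr_sqr ler_wsqrtr //.
by near: m; exact: nbhs_infty_ger.
Unshelve. all: by end_near. Qed.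

Lemma pow2_expR {R : realType} k : (2 ^+ k)^-1 = expR (- (k%:R * ln 2)) :> R.
Proof.
by rewrite expRN mulr_natl -lnXn // lnK // posrE exprn_gt0.
Qed.

Local Open Scope classical_set_scope.

Theorem theorem7p5 (R : realType) (delta : R) :
  0 < delta < 1 / 2 ->
  forall d : R, 0 < d ->
  exists (rt : nat -> nat) (c : R),
    0 < c /\
    (forall m : nat, (rt m <= m)%N) /\
    (exists L : R,
        (fun m : nat => (binom_le m (rt m))%:R / 2 ^+ m : R) @ \oo --> L /\
        (1 - d) * (1 - hbin delta) <= L) /\
    (\forall m \near \oo,
        a_mr delta m (rt m) <= (2 : R) `^ (- c * Num.sqrt (m%:R : R)) * 2 ^+ m).
Proof.
move=> t01 d d0.
have l2 := @ln2_gt0 R.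
pose gam := 1 - hbin delta.
have gam0 : 0 < gam by rewrite /gam; have := hbin_lt1 t01; lra.
have gam1 : gam <= 1.
  by rewrite /gam; have : 0 < delta < 1 by [lra]; move/hbin_ge0; lra.
(* Capping [d] at 1/2 keeps the target rate [L] positive; a smaller [d] only strengthens the
   bound. *)
pose d' := Num.min d (1 / 2).
have d'0 : 0 < d' by rewrite lt_min d0; lra.
have d'd : d' <= d by rewrite ge_min lexx.
have d'half : d' <= 1 / 2 by rewrite ge_min lexx orbT.
(* The gap [d' * gam] between the capacity [gam] and the target [L] is split into two halves [kap]:
   one absorbs the change of rate from [m] to [n] variables, the other leaves the bias [eta]. *)
pose L := (1 - d') * gam; pose kap := d' * gam / 2; pose eta := ln 2 * kap.
have L01 : 0 < L < 1 by rewrite /L; nra.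
have kap0 : 0 < kap by rewrite /kap divr_gt0 // mulr_gt0.
have kap1 : kap <= 1 / 4 by rewrite /kap; nra.
have eta0 : 0 < eta by rewrite mulr_gt0.
have /choice[rt rtP] : forall m, exists r, (r <= m)%N /\
    (1 <= L * 2 ^+ m -> L - (Num.sqrt m.+1%:R)^-1 <= rate m r <= L).
  (* Radius 0 is a filler for small [m]; by [evL] it eventually stops occurring. *)
  move=> m; have [H|H] := boolP (1 <= L * 2 ^+ m); last by exists 0%N.
  by have [r rm Hr] := exists_radius L01 H; exists r.
have evL : \forall m \near \oo, 1 <= L * 2 ^+ m.
  near=> m; have Lm : L^-1 <= m%:R by near: m; exact: nbhs_infty_ger.
  have L0 : 0 < L by lra.
  rewrite mulrC -ler_pdivrMr // div1r; apply: le_trans Lm _.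
  by rewrite -natrX ler_nat ltnW // ltn_expl.
(* The boosting yields the exponent [kap / 2]; half of it pays for the constant factors. *)
exists rt, (kap / 4); split; first by rewrite divr_gt0.
split; first by move=> m; exact: (rtP m).1.
split.
  exists L; split; last by rewrite /L -/gam; nra.
  apply/cvgrPdist_le => e e0; near=> m.
  have Lm : 1 <= L * 2 ^+ m by near: m.
  have em : e^-1 <= Num.sqrt m%:R by near: m; exact: near_sqrt_ge.
  have {}em : (Num.sqrt m.+1%:R)^-1 <= e.
    rewrite invf_ple ?posrE ?sqrtr_gt0 //; apply: le_trans em _.
    by rewrite ler_wsqrtr // ler_nat.
  have := (rtP m).2 Lm; rewrite -[_ / _]/(rate m (rt m)) ler_norml; lra.
near=> m.
have Lm : 1 <= L * 2 ^+ m by near: m.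
have sq1 : 1 <= Num.sqrt m%:R :> R by near: m; exact: near_sqrt_ge.
pose A := 8 / (eta * ln 2).
have sqA : A / (kap / 4 * ln 2) <= Num.sqrt m%:R by near: m; exact: near_sqrt_ge.
have := (rtP m).2 Lm; move: (rt m) => r; move: Lm sq1 sqA.
set sq := Num.sqrt m%:R => Lm sq1 sqA rateL.
have sqm : sq ^+ 2 = m%:R by rewrite sqr_sqrtr.
have ksq0 : 0 <= kap * sq by rewrite mulr_ge0 //; lra.
(* [k] is the integer part of [kap * sq], so that the loss of rate stays within [kap]. *)
have [n [k [mE /andP[kle kgt]]]] : exists n k,
    m = (n + k)%N /\ k%:R <= kap * sq < k.+1%:R.
  pose k := Num.truncn (kap * sq).
  have kitv : k%:R <= kap * sq < k.+1%:R by exact: truncn_itv.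
  have km : (k <= m)%N.
    by rewrite -(ler_nat R) -sqm; move: kitv => /andP[kk _]; apply: le_trans kk _; nra.
  by exists (m - k)%N, k; rewrite subnK.
(* As [k <= m / 4], at least [3 m / 4] variables remain in [n]. *)
have sn : sq <= 2 * Num.sqrt n.+1%:R.
  rewrite -(@ler_pXn2r _ 2) ?nnegrE ?mulr_ge0 ?sqrtr_ge0 //.
  rewrite sqm exprMn sqr_sqrtr // -[n.+1%:R]natr1.
  have ksq : kap * sq <= sq ^+ 2 / 4 by nra.
  have : m%:R = n%:R + k%:R :> R by rewrite mE natrD.
  by move: ksq; rewrite sqm; have := ler0n R n; lra.
have rn : rate n r <= L + kap.
  apply: le_trans (rate_shift n k r) _; rewrite -mE; apply: lerD; first by case/andP: rateL.
  rewrite ler_pdivrMr; last by lra.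
  by apply: le_trans kle _; rewrite ler_pM2l.
pose x := kap / 4 * sq * ln 2.
have xA : A <= x.
  by move: sqA; rewrite ler_pdivrMr ?mulr_gt0 //; rewrite /x; lra.
(* The positive solution of [s ^+ 2 * eta ^+ 2 = (2 ^+ k)^-1]. *)
pose s := expR (- (k%:R / 2 * ln 2)) / eta.
have s0 : 0 < s by rewrite divr_gt0 // expR_gt0.
have sx : 4 * s / ln 2 <= expR (- x).
  (* [k] exceeds [kap * sq - 1], so rounding costs at most a factor 2. *)
  have s_le : s <= 2 * expR (- (2 * x)) / eta.
    rewrite /s ler_pM2r ?invr_gt0 //.
    have e2 : expR (ln 2) = 2 :> R by rewrite lnK // posrE.
    rewrite -[X in _ <= X * _]e2 -expRD ler_expR.
    have := ler_wpM2r (ltW l2) (ltW kgt); rewrite -[k.+1%:R]natr1 /x; lra.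
  (* One of the two factors [expR (- x)] in [expR (- (2 * x))] absorbs the constant, since
     [A <= x <= expR x]. *)
  have -> : expR (- x) = expR x * expR (- (2 * x)) by rewrite -expRD; congr expR; ring.
  apply: (@le_trans _ _ (A * expR (- (2 * x)))).
    rewrite ler_pdivrMr //.
    have -> : A * expR (- (2 * x)) * ln 2 = 4 * (2 * expR (- (2 * x)) / eta).
      by rewrite /A; field; rewrite !gt_eqF.
    by rewrite ler_pM2l.
  rewrite ler_pM2r ?expR_gt0 //; apply: le_trans xA _.
  by have := expR_ge1Dx x; lra.
have x0 : 0 <= x by rewrite !mulr_ge0 // ?ltW //; lra.
have s_half : s <= 1 / 2.
  have ex1 : expR (- x) <= 1 by rewrite -expR0 ler_expR; lra.
  have := le_trans sx ex1; rewrite ler_pdivrMr //.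
  by have := @ln_sublinear R 2 ltac:(lra); lra.
apply: (@le_trans _ _ (2 ^+ m * (4 * s / ln 2))).
  rewrite mE; apply: (@a_mr_boost R delta eta s n k r) => //.
  - have -> : (binom_le n r)%:R = 2 ^+ n * rate n r :> R.
      by rewrite /rate mulrC divfK // gt_eqF // exprn_gt0.
    rewrite -mulrA -mulrBr ler_pM2l ?exprn_gt0 //.
    have -> : hnat delta = hbin delta * ln 2 by rewrite hbinE divfK // gt_eqF.
    have H : kap <= 1 - hbin delta - rate n r.
      by move: rn; rewrite /L -/gam /kap; lra.
    rewrite /eta; have := ler_wpM2l (ltW l2) H; lra.
  - by rewrite s0.
  rewrite -exprMn /s divfK ?gt_eqF // pow2_expR -expRM_natl; congr expR.
  by field.
rewrite mulrC ler_pM2r ?exprn_gt0 //; apply: le_trans sx _.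
rewrite /powR gt_eqF // ler_expR /x; lra.
Unshelve. all: by end_near. Qed.
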